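(* Let $q$ be a prime power, let $\mathrm{Q}=\mathrm{Q}(4,q)$ be a non-singular parabolic quadric of $\mathrm{PG}(4,q)$, let $\mathrm{Q}'$ be a quadric of $\mathrm{PG}(4,q)$ distinct from $\mathrm{Q}$, and let $V=\mathrm{Q}\cap\mathrm{Q}'$. If $|V|>q^2+11q+1$, then the pencil of quadrics defined by $\mathrm{Q}$ and $\mathrm{Q}'$ contains a quadric that is a union of two hyperplanes.
   Context: $\mathrm{PG}(4,q)$ is the $4$-dimensional projective space over $\mathbb{F}_q$. A quadric is given by a nonzero homogeneous quadratic polynomial over $\mathbb{F}_q$, up to nonzero scalar, and is identified with its set of $\mathbb{F}_q$-rational points when taking intersections and cardinalities; two quadrics are distinct if their polynomials are not proportional. The non-singular parabolic quadric $\mathrm{Q}(4,q)$ has, up to projective equivalence, equation $X_0^2+X_1X_2+X_3X_4=0$. If $\mathrm{Q}:f=0$ and $\mathrm{Q}':f'=0$, the pencil defined by $\mathrm{Q}$ and $\mathrm{Q}'$ is the set of the $q+1$ quadrics $\lambda f+\mu f'=0$, $(\lambda,\mu)\in\mathbb{F}_q^2\setminus\{(0,0)\}$ up to scalars. A union of two hyperplanes means a quadric whose form is a product of two non-proportional linear forms over $\mathbb{F}_q$. *)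

(* Defs.v *)
From mathcomp Require Import all_boot all_order all_algebra.
From mathcomp Require Import mpoly.

Set Implicit Arguments.
Unset Strict Implicit.
Unset Printing Implicit Defensive.

Import GRing.Theory.
Local Open Scope ring_scope.

Section Quadrics.

Variables (F : finFieldType) (n : nat).

(* A point of PG(n, q) is a 1-dimensional subspace of F^(n+1), given as the
   set of its vectors. *)
Definition line_of (v : 'rV[F]_n.+1) : {set 'rV[F]_n.+1} :=
  [set a *: v | a : F].

Definition PG : {set {set 'rV[F]_n.+1}} :=
  [set line_of v | v : 'rV[F]_n.+1 & v != 0].

(* Quadrics are represented by their equations; proportional equations
   define the same quadric. *)
Definition is_quadric (f : {mpoly F[n.+1]}) : Prop :=
  f != 0 /\ f \is 2.-homog.

Definition is_hyperplane (l : {mpoly F[n.+1]}) : Prop :=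
  l != 0 /\ l \is 1.-homog.

Definition proportional (f g : {mpoly F[n.+1]}) : Prop :=
  exists c : F, c != 0 /\ g = c *: f.

Definition quadric_points (f : {mpoly F[n.+1]}) : {set {set 'rV[F]_n.+1}} :=
  [set P in PG | [forall v in P, f.@[fun i => v 0 i] == 0]].

Definition in_pencil (f f' g : {mpoly F[n.+1]}) : Prop :=
  exists lam mu : F, (lam, mu) != (0, 0) /\ g = lam *: f + mu *: f'.

Definition is_hyperplane_pair (g : {mpoly F[n.+1]}) : Prop :=
  exists l1 l2 : {mpoly F[n.+1]},
    [/\ is_hyperplane l1, is_hyperplane l2, ~ proportional l1 l2 & g = l1 * l2].

Definition linear_subst (A : 'M[F]_n.+1) (f : {mpoly F[n.+1]}) :
  {mpoly F[n.+1]} :=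
  f \mPo [tuple \sum_(j < n.+1) A i j *: 'X_j | i < n.+1].

Definition proj_equiv (f g : {mpoly F[n.+1]}) : Prop :=
  exists A : 'M[F]_n.+1, A \in unitmx /\ proportional (linear_subst A f) g.

End Quadrics.

Definition Q4_form (F : finFieldType) : {mpoly F[5]} :=
  let X k := 'X_(inord k : 'I_5) in
  X 0%N ^+ 2 + X 1%N * X 2%N + X 3%N * X 4%N.

(* The classification of quadrics makes this, in every characteristic, the
   class of all non-singular quadrics of PG(4, q). *)
Definition is_Q4 (F : finFieldType) (f : {mpoly F[5]}) : Prop :=
  proj_equiv (Q4_form F) f.

(* Main.v *)
Require Import Defs.
From mathcomp Require Import all_boot all_order all_algebra.
From mathcomp Require Import mpoly zify ring.

(** The proof counts the zeros of the members of the pencil in F^5, where a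
    quadric with m points has 1 + (q - 1) m zeros. A common zero of f and f'
    lies on all q + 1 members and any other vector on exactly one; so if N is
    the number of common zeros, the q + 1 members have q^5 + q N zeros in total
    ([sum_zeros_pencil]). Many common zeros therefore force large members.

    No member is the zero form, as f and f' are not proportional. Two facts bound
    the members when none is a pair of hyperplanes.

    - A nonsingular form in 5 variables has at most q^4 zeros, and a nonzero form
      that is not a pair of hyperplanes at most q^4 + q^3 - q^2
      ([card_zeros_nonsingular], [card_zeros_not_pair]). Both come from splitting
      off a hyperbolic plane: if g v = g w = 0 and v, w have polar product 1, the
      space is the sum of the plane of v, w and its orthogonal W, and the zeros
      of g are counted by those of g on W ([card_zeros_split]). If g vanishes on
      W, it is the product of the linear forms polar to v and w.

    - At most nine of the members f + s f' are singular ([pencil_discriminant]).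
      The determinant of the Gram matrix G_s does not detect this in
      characteristic 2, where it vanishes identically in odd dimension. Instead
      consider the value of f + s f' on a fixed combination of the rows of the
      adjugate of G_s. If the form is singular at v, then the adjugate is zero or
      its rows lie in the left kernel of G_s, which is then the line of v; the
      value is 0 in both cases ([quad_adj_singular]). This is a polynomial in s
      of degree at most 1 + 2 * 4 = 9, and for f = Q4 and the first row it does
      not vanish at s = 0.

    Counting f' itself as possibly singular,
    q^5 + q N <= (q + 1) q^4 + 10 (q^3 - q^2), that is
    N <= 1 + (q - 1) (q^2 + 11 q + 1). *)

Set Implicit Arguments.
Unset Strict Implicit.
Unset Printing Implicit Defensive.

Import GRing.Theory.
Local Open Scope ring_scope.

(** * Zeros of quadratic forms on finite spaces *)

Section QuadraticForms.

Variables (F : finFieldType) (V : finLmodType F).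
Implicit Types (g : V -> F) (U : {set V}) (v w x y : V).

Definition polar g x y := g (x + y) - g x - g y.

Definition quadratic g :=
  (forall a x, g (a *: x) = a ^+ 2 * g x) /\
  (forall y a x x', polar g (a *: x + x') y = a * polar g x y + polar g x' y).

(** Subspaces are bare sets and their dimension is read off their cardinality,
    so that no bases are needed. *)
Definition subspace U := 0 \in U /\
  (forall a x y, x \in U -> y \in U -> a *: x + y \in U).

Definition zeros g U := [set x in U | g x == 0].

Definition singular_on g U :=
  exists v, [/\ v \in U, v != 0, g v = 0 & forall y, y \in U -> polar g v y = 0].

Definition hyperbolic_pair g v w := [/\ g v = 0, g w = 0 & polar g v w = 1].

Definition orth U g v w := [set x in U | (polar g v x == 0) && (polar g w x == 0)].

Local Notation q := #|F|.

Section Theory.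
Variables (g : V -> F) (Hg : quadratic g).

Lemma polarC x y : polar g x y = polar g y x.
Proof. by rewrite /polar [y + x]addrC; ring. Qed.

Lemma quadraticD x y : g (x + y) = g x + g y + polar g x y.
Proof. by rewrite /polar; ring. Qed.

Lemma quadraticZ a x : g (a *: x) = a ^+ 2 * g x.
Proof. by case: Hg. Qed.

Lemma quadratic0 : g 0 = 0.
Proof. by rewrite -(scale0r (0 : V)) quadraticZ expr0n mul0r. Qed.

Lemma polarDl x x' y : polar g (x + x') y = polar g x y + polar g x' y.
Proof. by have := Hg.2 y 1 x x'; rewrite scale1r mul1r. Qed.

Lemma polar0l y : polar g 0 y = 0.
Proof. by rewrite /polar add0r quadratic0; ring. Qed.

Lemma polarZl a x y : polar g (a *: x) y = a * polar g x y.
Proof. by have := Hg.2 y a x 0; rewrite polar0l !addr0. Qed.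

Lemma polarDr x y y' : polar g x (y + y') = polar g x y + polar g x y'.
Proof. by rewrite polarC polarDl !(polarC x). Qed.

Lemma polarZr a x y : polar g x (a *: y) = a * polar g x y.
Proof. by rewrite polarC polarZl polarC. Qed.

Lemma polarxx x : polar g x x = g x *+ 2.
Proof.
rewrite /polar -[x + x](_ : 2%:R *: x = _) ?quadraticZ; last first.
  by rewrite scaler_nat mulr2n.
by ring.
Qed.

Lemma subspaceZ U a x : subspace U -> x \in U -> a *: x \in U.
Proof. by case=> U0 Ul Ux; rewrite -[_ *: _]addr0 Ul. Qed.

Lemma subspaceD U x y : subspace U -> x \in U -> y \in U -> x + y \in U.
Proof. by case=> U0 Ul Ux Uy; rewrite -[x]scale1r Ul. Qed.

Lemma subspace_orth U v w : subspace U -> subspace (orth U g v w).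
Proof.
move=> sU; case: (sU) => U0 Ul; split.
  by rewrite inE U0 polarC polar0l polarC polar0l eqxx.
move=> a x y; rewrite !inE => /and3P[Ux /eqP vx /eqP wx] /and3P[Uy /eqP vy /eqP wy].
by rewrite Ul // !polarDr !polarZr vx wx vy wy mulr0 addr0 eqxx.
Qed.

(** A zero outside the radical spans a hyperbolic plane with a suitable second
    zero: on the line through y in direction v the form is affine with nonzero
    slope, hence vanishes somewhere. *)
Lemma hyperbolic_pair_exists U v y : subspace U -> v \in U -> y \in U ->
  g v = 0 -> polar g v y != 0 -> exists2 w, w \in U & hyperbolic_pair g v w.
Proof.
move=> sU Uv Uy gv nz; set b := polar g v y in nz.
exists (b^-1 *: y + (- (b^-1 ^+ 2 * g y)) *: v).
  by apply: subspaceD => //; apply: subspaceZ.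
split=> //.
  rewrite quadraticD !quadraticZ gv polarZl polarZr [polar g y v]polarC -/b.
  by rewrite mulr0 addr0 mulrCA mulVf // mulr1 subrr.
by rewrite polarDr !polarZr polarxx gv mul0rn mulr0 addr0 mulVf.
Qed.

(** Orthogonal projection to the complement of the plane spanned by v and w. *)
Definition orth_part v w x := x - polar g w x *: v - polar g v x *: w.

Lemma mem_orth_part U v w x : subspace U -> v \in U -> w \in U ->
  hyperbolic_pair g v w -> x \in U -> orth_part v w x \in orth U g v w.
Proof.
move=> sU Uv Uw [gv gw vw] Ux; rewrite !inE /orth_part -!scaleNr.
rewrite (subspaceD sU) ?(subspaceD sU) ?(subspaceZ _ sU) //=.
rewrite !polarDr !polarZr !polarxx gv gw [polar g w v]polarC vw !mul0rn.
by apply/andP; split; apply/eqP; ring.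
Qed.

(** With a hyperbolic pair (v, w), every vector of U is uniquely av + bw + x
    with x in W = orth U g v w, and the form there is ab + g x. *)

Section Splitting.
Variables (U : {set V}) (v w : V).
Hypotheses (sU : subspace U) (Uv : v \in U) (Uw : w \in U).
Hypothesis hyp : hyperbolic_pair g v w.
Let W := orth U g v w.

Let comb (z : F * F * V) : V := z.1.1 *: v + z.1.2 *: w + z.2.

Let polar_comb_v z : z.2 \in W -> polar g v (comb z) = z.1.2.
Proof.
case: hyp => gv gw vw; rewrite inE => /and3P[_ /eqP vx _].
by rewrite !polarDr !polarZr polarxx gv vw vx mul0rn; ring.
Qed.

Let polar_comb_w z : z.2 \in W -> polar g w (comb z) = z.1.1.
Proof.
case: hyp => gv gw vw; rewrite inE => /and3P[_ _ /eqP wx].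
by rewrite !polarDr !polarZr polarxx gw [polar g w v]polarC vw wx mul0rn; ring.
Qed.

Let g_comb z : z.2 \in W -> g (comb z) = z.1.1 * z.1.2 + g z.2.
Proof.
case: hyp => gv gw vw; rewrite inE => /and3P[_ /eqP vx /eqP wx].
rewrite !quadraticD !quadraticZ polarDl !polarZl !polarZr gv gw vw vx wx.
by ring.
Qed.

Let comb_inj z t : z.2 \in W -> t.2 \in W -> comb z = comb t -> z = t.
Proof.
move=> Wz Wt e.
have e2 : z.1.2 = t.1.2 by rewrite -(polar_comb_v Wz) -(polar_comb_v Wt) e.
have e1 : z.1.1 = t.1.1 by rewrite -(polar_comb_w Wz) -(polar_comb_w Wt) e.
move: e; rewrite /comb e1 e2 => /addrI.
by case: z t e1 e2 {Wz Wt} => [[a b] x] [[c d] y] /= -> -> ->.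
Qed.

Let mem_comb z : z.2 \in W -> comb z \in U.
Proof.
rewrite inE => /andP[Ux _].
by do !apply: subspaceD => //; apply: subspaceZ.
Qed.

Let decomp x := (polar g w x, polar g v x, orth_part v w x).

Let decompK x : comb (decomp x) = x.
Proof. by rewrite /comb /decomp /orth_part /= addrC addrA addrAC !subrK. Qed.

Let mem_decomp x : x \in U -> (decomp x).2 \in W.
Proof. exact: mem_orth_part. Qed.

Lemma card_hyperbolic_split : #|U| = (q ^ 2 * #|W|)%N.
Proof.
have -> : U = comb @: [set z | z.2 \in W].
  apply/setP=> x; apply/idP/imsetP => [Ux | [z]].
    by exists (decomp x); rewrite ?decompK // in_set; apply: mem_decomp.
  by rewrite in_set => Wz ->; apply: mem_comb.
rewrite card_in_imset; last first.
  by move=> z t; rewrite in_set => Wz; rewrite in_set; apply: comb_inj.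
rewrite (_ : [set z | _] = setX setT W).
  by rewrite cardsX cardsT card_prod mulnn.
by apply/setP=> -[ab x]; rewrite in_set in_setX in_setT.
Qed.

Let card_hyperbola c :
  #|[set ab : F * F | ab.1 * ab.2 + c == 0]| = (q.-1 + (c == 0%R) * q)%N.
Proof.
rewrite -sum1_card (eq_bigl (fun ab : F * F => ab.1 * ab.2 + c == 0)); last first.
  by move=> ab; rewrite in_set.
rewrite -(pair_big_dep xpredT (fun a b => a * b + c == 0) (fun _ _ => 1%N)) /=.
rewrite (bigD1 (0 : F)) //= addnC; congr (_ + _)%N.
  rewrite (eq_bigr (fun=> 1%N)) => [|a nz_a].
    by rewrite sum1_card -(cardC1 (0 : F)); apply: eq_card => a; rewrite !inE.
  rewrite (big_pred1 (- c / a)) // => b.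
  rewrite addr_eq0; apply/eqP/eqP => [<-|->].
    by rewrite mulrC mulKf.
  by rewrite mulrC divfK.
under eq_bigl do rewrite mul0r add0r.
by case: (c == 0); rewrite ?big_pred0_eq // sum1_card mul1n.
Qed.

(** The equation ab = -c has q - 1 solutions if c is nonzero and 2q - 1 if
    c = 0. *)
Lemma card_zeros_split :
  #|zeros g U| = (q.-1 * #|W| + q * #|zeros g W|)%N.
Proof.
have -> : zeros g U = comb @: [set z | (z.2 \in W) && (z.1.1 * z.1.2 + g z.2 == 0)].
  apply/setP=> x; apply/idP/imsetP => [|[z]].
    rewrite in_set => /andP[Ux gx]; have Wx := mem_decomp Ux.
    by exists (decomp x); rewrite ?decompK // in_set Wx -g_comb // decompK.
  rewrite in_set => /andP[Wz gz] ->.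
  by rewrite in_set mem_comb // g_comb.
rewrite card_in_imset; last first.
  move=> z t; rewrite in_set => /andP[? _]; rewrite in_set => /andP[? _].
  exact: comb_inj.
rewrite -sum1_card.
rewrite (eq_bigl (fun z : F * F * V =>
    (z.2 \in W) && (z.1.1 * z.1.2 + g z.2 == 0))); last first.
  by move=> z; rewrite in_set.
rewrite (partition_big (fun z => z.2) (mem W)) /=; last by move=> z /andP[].
transitivity (\sum_(x in W) (q.-1 + (g x == 0%R) * q))%N.
  apply: eq_bigr => x Wx; rewrite -card_hyperbola -sum1_card.
  rewrite (reindex (fun ab : F * F => (ab, x))) /=; last first.
    exists fst => [//|[ab y]]; rewrite inE /= => /andP[_ /eqP ->] //.
  by apply: eq_bigl => ab; rewrite [RHS]in_set /= (Wx : x \in W) eqxx andbT.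
rewrite big_split /= sum_nat_const mulnC; congr (_ + _)%N.
rewrite -big_distrl mulnC /=; congr (_ * _)%N.
rewrite -sum1_card [RHS](eq_bigl (fun x => (x \in W) && (g x == 0))).
  by rewrite big_mkcondr; apply: eq_bigr => x _; case: (g x == 0).
by move=> x; rewrite [LHS]in_set.
Qed.

End Splitting.

Lemma card_field_gt1 : (1 < q)%N.
Proof. by rewrite (cardD1 0) (cardD1 1) !inE oner_eq0. Qed.

(** The q translates of Z by multiples of x are disjoint. *)
Lemma card_subspace_proper U Z x : subspace U -> subspace Z -> Z \subset U ->
  x \in U -> x \notin Z -> (q * #|Z| <= #|U|)%N.
Proof.
move=> sU sZ ZU Ux nZx.
rewrite -cardX -cardsE -(card_in_imset (f := fun z : F * V => z.1 *: x + z.2)).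
  apply/subset_leq_card/subsetP => y /imsetP[z]; rewrite !inE => /= Zz ->.
  by apply: subspaceD => //; [apply: subspaceZ | apply: (subsetP ZU)].
move=> [a y] [b z]; rewrite !inE /= => Zy Zz e.
have Zab : (a - b) *: x \in Z.
  suff -> : (a - b) *: x = (-1) *: y + z by case: sZ => _; apply.
  rewrite scalerBl scaleN1r; apply/eqP.
  by rewrite [- y + z]addrC subr_eq addrAC eq_sym subr_eq addrC -e addrC.
have : a - b == 0.
  apply: contraR nZx => nz.
  by rewrite -[x]scale1r -(mulVf nz) -scalerA; apply: subspaceZ.
rewrite subr_eq0 => /eqP eab; move: e; rewrite eab => /addrI -> //.
Qed.

(** When every zero is orthogonal to U, the zeros are closed under addition,
    hence form a proper subspace. *)
Lemma card_zeros_totally_singular U x : subspace U -> x \in U -> g x != 0 ->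
  (forall v y, v \in zeros g U -> y \in U -> polar g v y = 0) ->
  (q * #|zeros g U| <= #|U|)%N.
Proof.
move=> sU Ux gx rad.
apply: (card_subspace_proper (x := x)) => //; last by rewrite inE Ux.
- case: (sU) => U0 Ul; split; first by rewrite inE U0 quadratic0 eqxx.
  move=> a y z Zy Zz; move: (Zy) (Zz); rewrite !inE => /andP[Uy /eqP gy] /andP[Uz /eqP gz].
  by rewrite Ul // quadraticD quadraticZ gy gz polarZl (rad y z) // !mulr0 !addr0 eqxx.
- by apply/subsetP => y; rewrite inE => /andP[].
Qed.

Lemma hyperbolic_or_totally_singular U : subspace U ->
  (exists v w, [/\ v \in U, w \in U & hyperbolic_pair g v w]) \/
  (forall v y, v \in zeros g U -> y \in U -> polar g v y = 0).
Proof.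
move=> sU.
case: (boolP [exists v in zeros g U, [exists y in U, polar g v y != 0]]).
  case/exists_inP => v; rewrite inE => /andP[Uv /eqP gv] /exists_inP[y Uy nz].
  by left; have [w Uw hyp] := hyperbolic_pair_exists sU Uv Uy gv nz; exists v, w.
move=> no; right => v y Zv Uy; apply/eqP; apply: contraNT no => nz.
by apply/exists_inP; exists v => //; apply/exists_inP; exists y.
Qed.

Lemma zeros_leq U : (#|zeros g U| <= #|U|)%N.
Proof. by apply/subset_leq_card/subsetP => x; rewrite inE => /andP[]. Qed.

(** The bound is attained by a product of two independent linear forms. *)
Lemma card_zeros_nonzero U x : subspace U -> x \in U -> g x != 0 ->
  (q ^ 2 * #|zeros g U| <= (2 * q - 1) * #|U|)%N.
Proof.
move=> sU Ux gx; have q1 := card_field_gt1.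
have [[v [w [Uv Uw hyp]]] | rad] := hyperbolic_or_totally_singular sU.
  rewrite (card_hyperbolic_split sU Uv Uw hyp) (card_zeros_split sU Uv Uw hyp).
  rewrite [leqRHS]mulnCA leq_mul2l; apply/orP; right.
  have := zeros_leq (orth U g v w).
  by move: #|zeros g (orth U g v w)| #|orth U g v w| => N W; nia.
have := card_zeros_totally_singular sU Ux gx rad.
rewrite -mulnn -mulnA => le_qN.
apply: leq_trans (leq_mul (leqnn q) le_qN) _.
by rewrite leq_mul2r; apply/orP; right; lia.
Qed.

(** The first alternative says that g is a product of two linear forms, see
    [orth_hyperbolicE]. Otherwise g is nonzero on the complement W of a
    hyperbolic plane and [card_zeros_nonzero] bounds its zeros on W; the result
    is the number of zeros of the cone over a hyperbolic quadric of PG(3, q). *)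
Lemma card_zeros_not_pair U x : subspace U -> x \in U -> g x != 0 ->
  (exists v w, [/\ v \in U, w \in U, hyperbolic_pair g v w &
     forall y, y \in orth U g v w -> g y = 0]) \/
  (q ^ 3 * #|zeros g U| <= (q ^ 2 + q - 1) * #|U|)%N.
Proof.
move=> sU Ux gx; have q1 := card_field_gt1.
have [[v [w [Uv Uw hyp]]] | rad] := hyperbolic_or_totally_singular sU.
  case: (boolP [exists y in orth U g v w, g y != 0]); last first.
    move=> no; left; exists v, w; split=> // y Wy; apply/eqP.
    by apply: contraNT no => nz; apply/exists_inP; exists y.
  case/exists_inP => y Wy gy; right.
  have := card_zeros_nonzero (subspace_orth v w sU) Wy gy.
  rewrite (card_hyperbolic_split sU Uv Uw hyp) (card_zeros_split sU Uv Uw hyp).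
  move: #|zeros g (orth U g v w)| #|orth U g v w| => N W le_N.
  have -> : (q ^ 3 * (q.-1 * W + q * N) = q ^ 2 * (q * q.-1 * W + q ^ 2 * N))%N.
    by rewrite !expnS expn0; ring.
  rewrite [leqRHS]mulnCA leq_mul2l; apply/orP; right.
  apply: leq_trans (leq_add (leqnn _) le_N) _.
  by rewrite -mulnDl leq_mul2r; apply/orP; right; nia.
right; have := card_zeros_totally_singular sU Ux gx rad.
rewrite expnSr -mulnA => le_qN.
apply: leq_trans (leq_mul (leqnn _) le_qN) _.
by rewrite leq_mul2r; apply/orP; right; lia.
Qed.

Lemma orth_hyperbolicE U v w y : subspace U -> v \in U -> w \in U ->
  hyperbolic_pair g v w -> (forall x, x \in orth U g v w -> g x = 0) ->
  y \in U -> g y = polar g v y * polar g w y.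
Proof.
move=> sU Uv Uw hyp W0 Uy; case: (hyp) => gv gw vw.
have ey : y = orth_part v w y + polar g v y *: w + polar g w y *: v.
  by rewrite /orth_part !subrK.
have := mem_orth_part sU Uv Uw hyp Uy; move: (orth_part v w y) ey => x ey Wx.
move: (Wx); rewrite inE => /and3P[_ /eqP vx /eqP wx].
rewrite {1}ey !quadraticD !quadraticZ polarDl !polarZl !polarZr gv gw.
by rewrite (polarC x w) (polarC x v) (polarC w v) vw vx wx (W0 _ Wx); ring.
Qed.

Lemma card_zeros_radical U :
  (forall v y, v \in zeros g U -> y \in U -> polar g v y = 0) ->
  ~ singular_on g U -> (#|zeros g U| <= 1)%N.
Proof.
move=> rad nsing; rewrite -(cards1 (0 : V)).
apply/subset_leq_card/subsetP => x Zx; rewrite inE.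
apply: contra_notT nsing => nz; have := Zx; rewrite inE => /andP[Ux /eqP gx].
by exists x; split=> // y; apply: rad.
Qed.

(** A vector of W = orth U g v w orthogonal to W is orthogonal to all of U,
    because U is the sum of W and the span of v and w. *)
Lemma singular_on_orth U v w : subspace U -> v \in U -> w \in U ->
  hyperbolic_pair g v w -> singular_on g (orth U g v w) -> singular_on g U.
Proof.
move=> sU Uv Uw hyp [x [Wx nz gx rad]]; exists x.
have := Wx; rewrite inE => /and3P[Ux /eqP vx /eqP wx]; split=> // y Uy.
have := rad _ (mem_orth_part sU Uv Uw hyp Uy).
rewrite /orth_part -!scaleNr !polarDr !polarZr.
by rewrite (polarC x v) (polarC x w) vx wx !mulr0 !addr0.
Qed.

(** As long as a nonsingular zero is left, a hyperbolic plane splits off and the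
    count passes from dimension 2k - 1 to 2k + 1 through
    (q - 1) q^(2k - 1) + q q^(2k - 2) = q^(2k). Otherwise 0 is the only zero,
    which is always so on a line: it has no room for a hyperbolic plane. *)
Lemma card_zeros_nonsingular k U : subspace U -> #|U| = (q ^ (2 * k).+1)%N ->
  ~ singular_on g U -> (#|zeros g U| <= q ^ (2 * k))%N.
Proof.
have q1 := card_field_gt1.
elim: k U => [|k IHk] U sU cU nsing;
  have [[v [w [Uv Uw hyp]]] | rad] := hyperbolic_or_totally_singular sU.
- have := card_hyperbolic_split sU Uv Uw hyp; rewrite cU expn1.
  by case: (#|orth _ _ _ _|) => [|m]; nia.
- exact: card_zeros_radical.
- have cW : #|orth U g v w| = (q ^ (2 * k).+1)%N.
    apply/eqP; rewrite -(eqn_pmul2l (m := q ^ 2)%N) ?expn_gt0 1?ltnW //.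
    rewrite -(card_hyperbolic_split sU Uv Uw hyp) cU -expnD; apply/eqP.
    by congr (_ ^ _)%N; lia.
  have nW : ~ singular_on g (orth U g v w).
    by move=> sing; apply: nsing; apply: singular_on_orth hyp sing.
  have := IHk _ (subspace_orth v w sU) cW nW.
  rewrite (card_zeros_split sU Uv Uw hyp) cW (_ : 2 * k.+1 = 2 + 2 * k)%N; last by lia.
  rewrite expnD expnS; move: (q ^ (2 * k))%N #|zeros g _| q1 => m N.
  by move: q => r; nia.
- apply: leq_trans (card_zeros_radical rad nsing) _.
  by rewrite expn_gt0 ltnW.
Qed.

End Theory.
End QuadraticForms.

(** * Quadratic forms, matrices and polynomials *)

Section MatrixForms.
Variables (R : comNzRingType) (n : nat).
Implicit Types (C D : 'M[R]_n) (x y : 'rV[R]_n).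

Definition quad C x : R := (x *m C *m x^T) 0 0.
Definition gram C : 'M[R]_n := C + C^T.

(** The polynomial counterpart of [quad]. The matrix is not assumed symmetric,
    so that every quadratic form has one in characteristic 2 too. *)
Definition mxform C : {mpoly R[n]} := \sum_i \sum_j C i j *: ('X_i * 'X_j).

Lemma quadE C x : quad C x = \sum_i \sum_j C i j * (x 0 i * x 0 j).
Proof.
rewrite /quad mxE exchange_big; apply: eq_bigr => j _.
rewrite mxE mulr_suml; apply: eq_bigr => i _.
by rewrite mxE mulrCA !mulrA.
Qed.

Lemma quadDl C D x : quad (C + D) x = quad C x + quad D x.
Proof. by rewrite /quad mulmxDr mulmxDl mxE. Qed.

Lemma quadZl a C x : quad (a *: C) x = a * quad C x.
Proof. by rewrite /quad -scalemxAr -scalemxAl mxE. Qed.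

Lemma quad0 C : quad C 0 = 0.
Proof. by rewrite /quad mul0mx mul0mx mxE. Qed.

Lemma quadZr a C x : quad C (a *: x) = a ^+ 2 * quad C x.
Proof. by rewrite /quad linearZ /= -!scalemxAl -scalemxAr scalerA mxE expr2. Qed.

Lemma quadDr C x y :
  quad C (x + y) - quad C x - quad C y = (x *m gram C *m y^T) 0 0.
Proof.
have yCx : y *m C *m x^T = x *m C^T *m y^T.
  apply/matrixP => i j; rewrite !ord1.
  by rewrite -[x *m _ *m _]trmxK [RHS]mxE !trmx_mul !trmxK mulmxA.
rewrite /quad linearD /= mulmxDr !mulmxDl yCx /gram mulmxDr mulmxDl.
by rewrite ![(_ + _ : 'M_1) 0 0]mxE; ring.
Qed.

Lemma quad_delta (i j : 'I_n) x : quad (delta_mx i j) x = x 0 i * x 0 j.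
Proof.
rewrite quadE (bigD1 i) //= (bigD1 j) //= mxE !eqxx mul1r !big1 ?addr0 //.
- by move=> k ki; apply: big1 => l _; rewrite mxE (negPf ki) mul0r.
- by move=> k kj; rewrite mxE (negPf kj) andbF mul0r.
Qed.

Lemma mxformE C (v : 'I_n -> R) :
  (mxform C).@[v] = quad C (\row_i v i).
Proof.
rewrite quadE rmorph_sum /=; apply: eq_bigr => i _; rewrite rmorph_sum /=.
by apply: eq_bigr => j _; rewrite mevalZ mevalM !mevalXU !mxE.
Qed.

Lemma mxformD C D : mxform (C + D) = mxform C + mxform D.
Proof.
rewrite -big_split; apply: eq_bigr => i _; rewrite -big_split.
by apply: eq_bigr => j _; rewrite /= mxE scalerDl.
Qed.

Lemma mxformZ a C : mxform (a *: C) = a *: mxform C.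
Proof.
rewrite scaler_sumr; apply: eq_bigr => i _; rewrite scaler_sumr.
by apply: eq_bigr => j _; rewrite /= mxE scalerA.
Qed.

Lemma mxform_delta (i j : 'I_n) : mxform (delta_mx i j) = 'X_i * 'X_j.
Proof.
rewrite /mxform (bigD1 i) //= (bigD1 j) //= mxE !eqxx scale1r !big1 ?addr0 //.
- by move=> k ki; apply: big1 => l _; rewrite mxE (negPf ki) scale0r.
- by move=> k kj; rewrite mxE (negPf kj) andbF scale0r.
Qed.

Lemma mxform_tr C : mxform C^T = mxform C.
Proof.
rewrite /mxform exchange_big; apply: eq_bigr => i _; apply: eq_bigr => j _.
by rewrite mxE mulrC.
Qed.

Lemma mdeg2E (m : 'X_{1..n}) : mdeg m = 2%N -> exists i j, m = (U_(i) + U_(j))%MM.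
Proof.
move=> m2.
have [i mi] : exists i, m i != 0%N.
  apply/existsP; rewrite -negb_forall; apply/negP => /forallP m0.
  by move: m2; rewrite mdegE big1 // => i _; apply/eqP.
have le_im : (U_(i) <= m)%MM by rewrite lep1mP.
have /eqP : mdeg (m - U_(i)) = 1%N.
  by apply/eqP; rewrite -(eqn_add2r (mdeg U_(i)%MM)) -mdegD submK // mdeg1 m2.
rewrite mdeg_eq1 => /existsP[j /eqP mj].
by exists j, i; rewrite -mj submK.
Qed.

Lemma homog2_mxform (f : {mpoly R[n]}) : f \is 2.-homog -> exists C, f = mxform C.
Proof.
move/dhomogP => hf.
suff [C eC] : exists C, mxform C = \sum_(m <- msupp f) f@_m *: 'X_[m].
  by exists C; rewrite eC -mpolyE.
elim: (msupp f) hf => [|m s IHs] hs.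
  exists 0; rewrite big_nil /mxform big1 // => i _; apply: big1 => j _.
  by rewrite mxE scale0r.
have [i [j mij]] := mdeg2E (hs m (mem_head _ _)).
have [C eC] : exists C, mxform C = \sum_(m <- s) f@_m *: 'X_[m].
  by apply: IHs => k ks; apply: hs; rewrite inE ks orbT.
exists (f@_m *: delta_mx i j + C).
by rewrite big_cons mxformD mxformZ mxform_delta -mpolyXD -mij eC.
Qed.

(** Such a C is alternating, so it is T - T^T for its strictly upper part T, and
    a matrix and its transpose give the same polynomial. *)
Lemma mxform_eq0 C : (forall x, quad C x = 0) -> mxform C = 0.
Proof.
move=> C0.
have Cii i : C i i = 0.
  by rewrite -[RHS](C0 (delta_mx 0 i)) /quad trmx_delta -rowE -colE !mxE.
have Cij i j : C i j = - C j i.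
  have := quadDr C (delta_mx 0 i) (delta_mx 0 j).
  rewrite !C0 !subr0 trmx_delta -rowE -colE !mxE => /esym/eqP.
  by rewrite addr_eq0 => /eqP.
pose T : 'M[R]_n := \matrix_(i, j) (C i j *+ (i < j)%N).
have -> : C = T + (-1) *: T^T.
  apply/matrixP => i j; rewrite !mxE mulN1r.
  have [ij|ji|/val_inj ->] := ltngtP i j; rewrite ?Cii ?mulr1n ?mulr0n.
  - by rewrite subr0.
  - by rewrite add0r Cij.
  - by rewrite subrr.
by rewrite mxformD mxformZ mxform_tr scaleN1r subrr.
Qed.

End MatrixForms.

(** Quadratic forms are determined by their values even over the field with two
    elements: the values at basis vectors and at sums of two of them give all
    coefficients. *)
Lemma homog2_eval_inj (F : finFieldType) n (f g : {mpoly F[n]}) :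
  f \is 2.-homog -> g \is 2.-homog ->
  (forall x : 'rV[F]_n, f.@[fun i => x 0 i] = g.@[fun i => x 0 i]) -> f = g.
Proof.
move=> hf hg fg; apply/eqP; rewrite -subr_eq0; apply/eqP.
have [C eC] : exists C, f - g = mxform C.
  by apply: homog2_mxform; rewrite rpredB.
rewrite eC; apply: mxform_eq0 => x.
have := fg x; move/eqP; rewrite -subr_eq0 -mevalB eC mxformE => /eqP.
by congr (quad C _ = 0); apply/rowP => i; rewrite mxE.
Qed.

Lemma map_quad (R S : comNzRingType) (h : {rmorphism R -> S}) n (C : 'M[R]_n) x :
  h (quad C x) = quad (map_mx h C) (map_mx h x).
Proof. by rewrite /quad map_trmx -!map_mxM [RHS]mxE. Qed.

(** * Singular members of a pencil *)

Section Singular.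
Variable F : finFieldType.

Definition singular n (g : 'rV[F]_n -> F) := singular_on g setT.

Lemma quadratic_quad n (C : 'M[F]_n) : quadratic (quad C).
Proof.
split=> [a x|y a x x']; first exact: quadZr.
by rewrite /polar !quadDr !mulmxDl mxE -!scalemxAl mxE.
Qed.

Lemma singular_gram n (C : 'M[F]_n) : singular (quad C) ->
  exists v, [/\ v != 0, quad C v = 0 & v *m gram C = 0].
Proof.
case=> v [_ nz qv rad]; exists v; split=> //.
apply/rowP => i; have := rad (delta_mx 0 i) (in_setT _).
by rewrite /polar quadDr trmx_delta -colE !mxE.
Qed.

(** A nonzero entry of the adjugate is a nonzero minor of order n - 1. *)
Lemma rank_adj_neq0 n (G : 'M[F]_n) : \adj G != 0 -> (n.-1 <= \rank G)%N.
Proof.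
move=> nz; have [i [j nzij]] : exists i j, \adj G i j != 0.
  case: (pickP (fun ij => \adj G ij.1 ij.2 != 0)) => [[i j] ?|h].
    by exists i, j.
  case/eqP: nz; apply/matrixP => i j; rewrite [RHS]mxE.
  by have /negbFE/eqP := h (i, j).
move: nzij; rewrite mxE /cofactor mulf_eq0 signr_eq0 /= -unitfE => u.
have <- : \rank (row' j (col' i G)) = n.-1 by apply: mxrank_unit; rewrite unitmxE.
rewrite row'Esub; apply: leq_trans (mxrankS (rowsub_sub _ _)) _.
by rewrite -mxrank_tr tr_col' row'Esub -[leqRHS]mxrank_tr mxrankS // rowsub_sub.
Qed.

(** If the Gram matrix has rank n - 1 its left kernel is the line of the
    singular vector, which contains every combination of rows of the adjugate;
    if the rank is smaller, the adjugate vanishes. *)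
Lemma quad_adj_singular n (C : 'M[F]_n) u : singular (quad C) ->
  quad C (u *m \adj (gram C)) = 0.
Proof.
case/singular_gram => v [nz qv vG].
have [->|/rank_adj_neq0 rkG] := eqVneq (\adj (gram C)) 0.
  by rewrite mulmx0 quad0.
have v_ker : (v <= kermx (gram C))%MS by apply/sub_kermxP.
have rk_ker : (\rank (kermx (gram C)) <= \rank v)%N.
  by rewrite mxrank_ker rank_rV nz; lia.
have detG : \det (gram C) = 0.
  apply/eqP/det0P; by exists v.
have : (u *m \adj (gram C) <= v)%MS.
  apply: submx_trans (_ : kermx (gram C) <= v)%MS.
    by apply/sub_kermxP; rewrite -mulmxA mul_adj_mx detG scalar_mxC mul_scalar_mx scale0r.
  by rewrite -(mxrank_leqif_sup v_ker).2; rewrite eqn_leq rk_ker mxrankS.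
case/sub_rVP => a ->; by rewrite quadZr qv mulr0.
Qed.

End Singular.

Section SizeBounds.
Variable R : comNzRingType.

Lemma size_mul_bound (p r : {poly R}) a b :
  (size p <= a.+1)%N -> (size r <= b.+1)%N -> (size (p * r)%R <= (a + b).+1)%N.
Proof. by move=> pa rb; apply: leq_trans (size_polyMleq _ _) _; lia. Qed.

Lemma size_sum_bound I (s : seq I) (P : pred I) (p : I -> {poly R}) d :
  (forall i, P i -> (size (p i) <= d)%N) -> (size (\sum_(i <- s | P i) p i)%R <= d)%N.
Proof.
move=> h; apply: (big_ind (fun r : {poly R} => (size r <= d)%N)) => //.
  by rewrite size_poly0.
by move=> r t hr ht; apply: leq_trans (size_polyD _ _) _; rewrite geq_max hr.
Qed.

Lemma size_det_linear n (M : 'M[{poly R}]_n) :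
  (forall i j, (size (M i j) <= 2)%N) -> (size (\det M) <= n.+1)%N.
Proof.
move=> hM; apply: size_sum_bound => s _.
rewrite -[n.+1]/(0 + n).+1%N; apply: size_mul_bound.
  by rewrite -polyC1 -polyCN -polyC_exp; apply: size_polyC_leq1.
rewrite -[X in (_ <= X.+1)%N]card_ord -sum1_card.
apply: (big_ind2 (fun (p : {poly R}) d => (size p <= d.+1)%N)) => //.
- by rewrite size_poly1.
- by move=> p a r b; apply: size_mul_bound.
Qed.

Lemma size_adj_linear n (M : 'M[{poly R}]_n) :
  (forall i j, (size (M i j) <= 2)%N) -> forall i j, (size (\adj M i j) <= n.-1.+1)%N.
Proof.
move=> hM i j; rewrite mxE /cofactor.
rewrite -[n.-1.+1]/(0 + n.-1).+1%N; apply: size_mul_bound.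
  by rewrite -polyC1 -polyCN -polyC_exp; apply: size_polyC_leq1.
by apply: size_det_linear => k l; rewrite !mxE.
Qed.

End SizeBounds.

Section Q4.
Variable F : finFieldType.

Definition Q4_mx : 'M[F]_5 :=
  delta_mx (inord 0) (inord 0) + delta_mx (inord 1) (inord 2)
  + delta_mx (inord 3) (inord 4).

Lemma mxform_Q4 : mxform Q4_mx = Q4_form F.
Proof. by rewrite !mxformD !mxform_delta /Q4_form expr2. Qed.

Lemma quad_Q4 x : quad Q4_mx x = x 0 (inord 0) ^+ 2
  + x 0 (inord 1) * x 0 (inord 2) + x 0 (inord 3) * x 0 (inord 4).
Proof. by rewrite !quadDl !quad_delta expr2. Qed.

Let r : 'rV[F]_5 := row (inord 0) (\adj (gram Q4_mx)).

Let mul_delta (x : 'rV[F]_5) (i j k : 'I_5) : (x *m delta_mx i j) 0 k = x 0 i *+ (k == j).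
Proof.
rewrite mxE (bigD1 i) //= mxE eqxx big1 ?addr0 ?mulr_natr // => l li.
by rewrite mxE (negPf li) mulr0.
Qed.

Let r_gram k : (r *m gram Q4_mx) 0 k = \det (gram Q4_mx) *+ (k == inord 0).
Proof.
by rewrite /r -row_mul mul_adj_mx !mxE eq_sym.
Qed.

Let r_0 : r 0 (inord 0) != 0.
Proof.
rewrite mxE mxE /cofactor mulf_eq0 signr_eq0 /= -unitfE.
set M := row' _ _; rewrite -[\det M \in _]/(M \in unitmx).
(* This minor is the Gram matrix of X1 X2 + X3 X4, an involution. *)
suff : M *m M = 1%:M by case/mulmx1_unit.
rewrite {}/M.
apply/matrixP => i j; rewrite !mxE.
rewrite !big_ord_recl big_ord0 !mxE -!val_eqE /= !inordK //.
case: i j => [[|[|[|[|//]]]] i_lt] [[|[|[|[|//]]]] j_lt] /=.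
all: by rewrite /bump /=; ring.
Qed.

(** The row is a nonzero multiple of the first basis vector, on which Q4 does
    not vanish; in characteristic 2 this is the nucleus of the quadric. *)
Lemma quad_Q4_adj : quad Q4_mx r != 0.
Proof.
have gramE : gram Q4_mx = delta_mx (inord 0) (inord 0) + delta_mx (inord 1) (inord 2)
  + delta_mx (inord 3) (inord 4) + (delta_mx (inord 0) (inord 0) + delta_mx (inord 2) (inord 1)
  + delta_mx (inord 4) (inord 3)).
  by rewrite /gram /Q4_mx !linearD /= !trmx_delta.
have r2 : r 0 (inord 2) = 0.
  have := r_gram (inord 1); rewrite gramE !mulmxDr.
  rewrite ![(_ + _ : 'rV_5) 0 _]mxE !mul_delta -!val_eqE /= !inordK //=.
  by rewrite !mulr0n !add0r !addr0.
have r4 : r 0 (inord 4) = 0.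
  have := r_gram (inord 3); rewrite gramE !mulmxDr.
  rewrite ![(_ + _ : 'rV_5) 0 _]mxE !mul_delta -!val_eqE /= !inordK //=.
  by rewrite !mulr0n !add0r.
by rewrite quad_Q4 r2 r4 !mulr0 !addr0 expf_neq0 ?r_0.
Qed.

(** The polynomial is the value at X of the form Q4 + X D on a row of the
    adjugate of its Gram matrix: an adjugate of linear entries has degree 4, so
    the degree is at most 1 + 2 * 4 = 9. Its value at X = 0 comes from Q4 alone. *)
Lemma Q4_pencil_discriminant (D : 'M[F]_5) : exists P : {poly F},
  [/\ P != 0, (size P <= 10)%N &
      forall s, singular (quad (Q4_mx + s *: D)) -> root P s].
Proof.
pose C := map_mx polyC Q4_mx + 'X *: map_mx polyC D.
have evC s : map_mx (horner_eval s) C = Q4_mx + s *: D.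
  by apply/matrixP => i j; rewrite !mxE /horner_eval !hornerE.
have evG s : map_mx (horner_eval s) (gram C) = gram (Q4_mx + s *: D).
  by rewrite /gram map_mxD -map_trmx evC.
pose P := quad C (row (inord 0) (\adj (gram C))).
have evP s : P.[s] = quad (Q4_mx + s *: D)
    (row (inord 0) (\adj (gram (Q4_mx + s *: D)))).
  by rewrite -[P.[s]]/(horner_eval s P) map_quad evC map_row map_mx_adj evG.
exists P; split.
- apply: contraNneq quad_Q4_adj => P0.
  by have := evP 0; rewrite P0 horner0 scale0r addr0 => <-.
- have sC i j : (size (C i j) <= 2)%N.
    rewrite !mxE; apply: leq_trans (size_polyD _ _) _; rewrite geq_max.
    rewrite (leq_trans (size_polyC_leq1 _)) //.
    by rewrite (@size_mul_bound _ _ _ 1 0) ?size_polyX ?size_polyC_leq1.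
  have sG i j : (size (gram C i j) <= 2)%N.
    rewrite mxE [_^T _ _]mxE.
    by apply: leq_trans (size_polyD _ _) _; rewrite geq_max !sC.
  rewrite /P quadE; apply: size_sum_bound => i _; apply: size_sum_bound => j _.
  apply: (@size_mul_bound _ _ _ 1 8) => //; apply: (@size_mul_bound _ _ _ 4 4).
    by rewrite mxE; apply: (size_adj_linear sG).
  by rewrite mxE; apply: (size_adj_linear sG).
- move=> s sing; rewrite rootE evP rowE; apply/eqP; exact: quad_adj_singular.
Qed.

End Q4.

(** * Points and hyperplane pairs *)

Section Points.
Variable F : finFieldType.
Variable n : nat.
Local Notation q := #|F|.
Implicit Types f g : {mpoly F[n.+1]}.

Definition value f (x : 'rV[F]_n.+1) : F := f.@[fun i => x 0 i].

Definition common_zeros f g : {set 'rV[F]_n.+1} :=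
  [set x | (value f x == 0) && (value g x == 0)].

Lemma card_line_punctured (v : 'rV[F]_n.+1) : v != 0 -> #|line_of v :\ 0| = q.-1.
Proof.
move=> nz; have <- : #|line_of v| = q.
  rewrite card_imset ?cardsT // => a b /eqP; rewrite -subr_eq0 -scalerBl.
  by rewrite scaler_eq0 (negPf nz) orbF subr_eq0 => /eqP.
rewrite [in RHS](cardsD1 0) (_ : 0 \in line_of v) //.
by apply/imsetP; exists 0; rewrite ?scale0r.
Qed.

Lemma line_ofZ a (v : 'rV[F]_n.+1) : a != 0 -> line_of (a *: v) = line_of v.
Proof.
move=> nz; apply/setP => x; apply/imsetP/imsetP => -[b _ ->].
  by exists (b * a); rewrite ?scalerA.
by exists (b / a); rewrite // scalerA divfK.
Qed.

Lemma card_points_le_zeros f g :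
  (q.-1 * #|quadric_points f :&: quadric_points g| <= #|common_zeros f g :\ 0%R|)%N.
Proof.
set S := _ :&: _; set Z := _ :\ 0.
have SP P : P \in S -> exists2 v, v != 0 & P = line_of v /\ line_of v :\ 0 \subset Z.
  rewrite !inE => /andP[/andP[/imsetP[v nz ->] /forall_inP f0] /andP[_ /forall_inP g0]].
  exists v; [by move: nz; rewrite inE | split=> //].
  apply/subsetP => x; rewrite !inE => /andP[-> vx].
  by rewrite /value f0 ?g0.
rewrite mulnC -sum_nat_const -[leqRHS]sum1_card.
rewrite (bigID (fun x => line_of x \in S)) /=; apply: leq_trans (leq_addr _ _).
rewrite (partition_big (@line_of F n) (mem S)) /=; last by move=> x /andP[].
apply: leq_sum => P PS; have [v nz [eP subZ]] := SP P PS.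
rewrite -(card_line_punctured nz) -sum1_card.
rewrite [leqRHS]big_mkcond [leqLHS]big_mkcond; apply: leq_sum => x _.
case: ifP => // vx; rewrite (subsetP subZ x vx) /=.
move: vx; rewrite in_setD1 => /andP[nzx /imsetP[a _ ex]].
have nza : a != 0 by apply: contraNneq nzx => a0; rewrite ex a0 scale0r.
by rewrite ex line_ofZ // -eP PS eqxx.
Qed.

End Points.

Section Forms.
Variables (F : finFieldType) (n : nat).
Implicit Types (f g : {mpoly F[n.+1]}) (C : 'M[F]_n.+1).

Lemma value_mxform C : value (mxform C) =1 quad C.
Proof.
by move=> x; rewrite /value mxformE; congr quad; apply/rowP => i; rewrite mxE.
Qed.

Lemma eq_polar (V : finLmodType F) (g h : V -> F) : g =1 h -> polar g =2 polar h.
Proof. by move=> gh x y; rewrite /polar !gh. Qed.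

Lemma quadratic_value f : f \is 2.-homog -> quadratic (value f).
Proof.
case/homog2_mxform => C ->; have [qZ qD] := quadratic_quad C.
split=> [a x|y a x x']; rewrite !(value_mxform, eq_polar (value_mxform C)) //.
Qed.

Lemma value_neq0 f : f \is 2.-homog -> f != 0 -> exists x, value f x != 0.
Proof.
move=> hf nz; apply/existsP; apply: contraNT nz; rewrite negb_exists => /forallP f0.
apply/eqP; apply: homog2_eval_inj => // [|x]; first exact: dhomog0.
by rewrite meval0; apply/eqP; have := f0 x; rewrite negbK.
Qed.

Lemma subspace_setT (V : finLmodType F) : subspace [set: V].
Proof. by split=> *; rewrite in_setT. Qed.

Definition linform (u : 'rV[F]_n.+1) : {mpoly F[n.+1]} := \sum_i u 0 i *: 'X_i.

Lemma value_linform u x : value (linform u) x = (u *m x^T) 0 0.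
Proof.
rewrite /value rmorph_sum mxE; apply: eq_bigr => i _.
by rewrite /= mevalZ mevalXU mxE.
Qed.

Lemma linform_homog u : linform u \is 1.-homog.
Proof.
by apply: rpred_sum => i _; apply: rpredZ; rewrite dhomogX; apply/eqP/mdeg1.
Qed.

(** The two hyperplanes are the polars of v and w. *)
Lemma hyperbolic_is_hyperplane_pair f v w : f \is 2.-homog ->
  hyperbolic_pair (value f) v w ->
  (forall y, y \in orth setT (value f) v w -> value f y = 0) ->
  is_hyperplane_pair f.
Proof.
move=> hf hyp f0; have qf := quadratic_value hf.
have [C eC] := homog2_mxform hf.
pose l u := linform (u *m gram C).
have valE u x : value (l u) x = polar (value f) u x.
  by rewrite value_linform eC (eq_polar (value_mxform C)) /polar quadDr.
have [fv fw vw] := hyp.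
have vv : value (l v) v = 0 by rewrite valE polarxx // fv mul0rn.
have wv : value (l w) v = 1 by rewrite valE polarC.
have lv_w : value (l v) w = 1 by rewrite valE.
exists (l v), (l w); split.
- split; last exact: linform_homog.
  by apply: contra_eq_neq lv_w => ->; rewrite /value meval0 eq_sym oner_neq0.
- split; last exact: linform_homog.
  by apply: contra_eq_neq wv => ->; rewrite /value meval0 eq_sym oner_neq0.
- case=> c [_ e]; move: wv; rewrite e /value mevalZ -/(value _ _) vv mulr0.
  by move/eqP; rewrite eq_sym oner_eq0.
- apply: homog2_eval_inj => // [|x].
    by apply: (@dhomogM _ _ _ 1 _ 1); apply: linform_homog.
  rewrite mevalM -!/(value _ _) !valE.
  apply: (orth_hyperbolicE qf (@subspace_setT _)) => //; exact: in_setT.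
Qed.

End Forms.

(** * Counting in the pencil *)

Section Pencil.
Variable F : finFieldType.
Local Notation q := #|F|.
Implicit Types (f g : {mpoly F[5]}).

Lemma hyperplane_pair_or_card_zeros f : f \is 2.-homog -> f != 0 ->
  is_hyperplane_pair f \/
  (#|zeros (value f) setT| <= q ^ 4 + (q ^ 3 - q ^ 2))%N.
Proof.
move=> hf nz; have q1 := card_field_gt1 F.
have [x fx] := value_neq0 hf nz.
have [[v [w [_ _ hyp W0]]]|] := card_zeros_not_pair (quadratic_value hf)
  (subspace_setT _) (in_setT x) fx.
  by left; apply: hyperbolic_is_hyperplane_pair hyp W0.
rewrite cardsT card_mx mul1n (expnD q 3 2) mulnCA leq_pmul2l; last first.
  by rewrite expn_gt0 ltnW.
move=> le_N; right; apply: leq_trans le_N _.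
by rewrite !expnS expn0 !muln1; nia.
Qed.

Lemma card_zeros_nonsingular_form f : f \is 2.-homog -> ~ singular (value f) ->
  (#|zeros (value f) setT| <= q ^ 4)%N.
Proof.
move=> hf; apply: (card_zeros_nonsingular (k := 2) (quadratic_value hf)).
  exact: subspace_setT.
by rewrite cardsT card_mx mul1n.
Qed.

Lemma is_Q4_value f : is_Q4 f -> exists c (B : 'M[F]_5),
  [/\ c != 0, B \in unitmx, f \is 2.-homog &
      forall x, value f x = c * quad (Q4_mx F) (x *m B)].
Proof.
case=> A [uA [c [nz ->]]]; exists c, A^T; split=> //.
- by rewrite unitmx_tr.
- apply: rpredZ; rewrite /linear_subst /Q4_form.
  have hT i : 'X_i \mPo [tuple \sum_(j < 5) A i j *: 'X_j | i < 5] \is 1.-homog.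
    rewrite comp_mpolyXU -tnth_nth tnth_mktuple.
    by apply: rpred_sum => j _; apply: rpredZ; rewrite dhomogX; apply/eqP/mdeg1.
  by rewrite !rmorphD !rmorphM /= !rpredD //; apply: (@dhomogM _ _ _ 1 _ 1).
- move=> x; rewrite /value mevalZ /linear_subst comp_mpoly_meval -mxform_Q4.
  rewrite mxformE; congr (_ * quad _ _); apply/rowP => i.
  rewrite !mxE tnth_mktuple rmorph_sum; apply: eq_bigr => j _.
  by rewrite /= mevalZ mevalXU mxE mulrC.
Qed.

(** The change of coordinates that turns f into a multiple of Q4 keeps the
    singular members singular. *)
Lemma pencil_discriminant f g : is_Q4 f -> g \is 2.-homog ->
  exists P : {poly F}, [/\ P != 0, (size P <= 10)%N &
    forall s, singular (value (f + s *: g)) -> root P s].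
Proof.
case/is_Q4_value => c [B [nz uB _ fE]] /homog2_mxform[D ->].
pose B1 := invmx B; pose E := c^-1 *: (B1 *m D *m B1^T).
have fsE s x : quad (Q4_mx F + s *: E) (x *m B) = c^-1 * value (f + s *: mxform D) x.
  rewrite /value mevalD mevalZ -!/(value _ _) fE value_mxform mulrDr mulKf //.
  rewrite quadDl !quadZl mulrCA; congr (_ + _ * (_ * _)).
  by rewrite /quad trmx_mul /B1 trmx_inv !mulmxA mulmxK // mulmxKV ?unitmx_tr.
have [P [P0 sP Psing]] := Q4_pencil_discriminant E.
exists P; split=> // s [v [_ nzv fv rad]]; apply: Psing.
exists (v *m B); split; rewrite ?in_setT //.
- by apply: contraNneq nzv => e; rewrite -(mulmxK uB v) e mul0mx.
- by rewrite fsE fv mulr0.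
move=> y _; rewrite -(mulmxKV uB y) /polar -mulmxDl !fsE -!mulrBr.
by have := rad (y *m B1) (in_setT _); rewrite /polar => ->; rewrite mulr0.
Qed.

(** A common zero lies on all q + 1 members of the pencil, any other vector on
    exactly one. *)
Lemma sum_zeros_pencil (V : finType) (a b : V -> F) :
  (\sum_s #|[set x | (a x + s * b x == 0)%R]| + #|[set x | b x == 0%R]|
   = #|V| + q * #|[set x | (a x == 0%R) && (b x == 0%R)]|)%N.
Proof.
have cardE (p : pred V) : #|[set x | p x]| = (\sum_x p x)%N.
  by rewrite -sum1_card big_mkcond; apply: eq_bigr => x _; rewrite in_set; case: (p x).
under eq_bigr do rewrite cardE.
rewrite exchange_big !cardE -big_split -sum1_card big_distrr -big_split /=.
apply: eq_bigr => x _.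
have [b0|nb] := eqVneq (b x) 0.
  under eq_bigr do rewrite b0 mulr0 addr0.
  by rewrite sum_nat_const andbT addnC.
rewrite (bigD1 (- a x / b x)) //= divfK // subrr eqxx big1 ?andbF ?muln0 //.
move=> s ns; apply/eqP; rewrite eqb0; apply: contra ns.
by rewrite addrC addr_eq0 => /eqP <-; rewrite mulfK.
Qed.

End Pencil.

(** The contradiction between the two counts, for v points and N common zeros,
    z zeros of f', S1 singular members f + s f' and S2 zeros of all of these. *)
Lemma pencil_count_absurd q v N z S1 S2 : (S1 <= 9)%N ->
  (z <= q ^ 4 + (q ^ 3 - q ^ 2))%N -> (q ^ 2 + 11 * q + 1 < v)%N ->
  (1 < q)%N -> (0 < N)%N -> (q.-1 * v <= N.-1)%N ->
  (S2 <= q * q ^ 4 + S1 * (q ^ 3 - q ^ 2))%N ->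
  (S2 + z)%N = (q ^ 5 + q * N)%N -> False.
Proof.
move=> S9 le_z lt_v q1 N0 le_v le_S2 eS.
have le_qN : (q * N <= q * (q ^ 3 + 10 * (q ^ 2 - q)))%N.
  have -> : (q * (q ^ 3 + 10 * (q ^ 2 - q)) = q ^ 4 + 10 * (q ^ 3 - q ^ 2))%N.
    by rewrite mulnDr mulnCA mulnBr -!expnS -mulnn.
  have le9 := leq_mul S9 (leqnn (q ^ 3 - q ^ 2)).
  rewrite -expnS in le_S2; lia.
rewrite leq_pmul2l ?(ltnW q1) // in le_qN.
case: q q1 {le_z le_S2 eS} lt_v le_v le_qN => [//|r] r0 lt_v /= le_v le_N.
have le_rv := leq_trans (leq_mul (leqnn r) lt_v) le_v.
rewrite !expnS expn0 !muln1 in le_rv le_N; nia.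
Qed.

Theorem theorem3p4 (F : finFieldType) (q : nat) (hq : #|F| = q)
    (f f' : {mpoly F[5]})
    (hf : is_Q4 f) (hf' : is_quadric f') (hdist : ~ proportional f f')
    (hV : (q ^ 2 + 11 * q + 1 < #|quadric_points f :&: quadric_points f'|)%N) :
  exists g : {mpoly F[5]}, in_pencil f f' g /\ is_hyperplane_pair g.
Proof.
case: hf' => nzf' homf'.
have [c [B [nzc uB homf fE]]] := is_Q4_value hf.
have [P [P0 sP Psing]] := pencil_discriminant hf homf'.
have homg s : f + s *: f' \is 2.-homog by rewrite rpredD ?rpredZ.
have nzf : f != 0.
  apply: contraNneq (mulf_neq0 nzc (quad_Q4_adj F)) => f0.
  by rewrite -(mulmxKV uB (row _ _)) -fE f0 /value meval0.
have nzg s : f + s *: f' != 0.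
  have [->|nzs] := eqVneq s 0; first by rewrite scale0r addr0.
  apply/eqP => /eqP; rewrite addr_eq0 => /eqP ef.
  apply: hdist; exists (- s^-1); rewrite oppr_eq0 invr_eq0 ef.
  by rewrite scaleNr scalerN opprK scalerA mulVf ?scale1r.
have [pair|le_f'] := hyperplane_pair_or_card_zeros homf' nzf'.
  exists f'; split=> //; exists 0, 1; rewrite scale0r scale1r add0r; split=> //.
  by rewrite xpair_eqE oner_eq0 andbF.
case: (boolP [forall s, #|zeros (value (f + s *: f')) setT|
    <= q ^ 4 + (q ^ 3 - q ^ 2)]%N); last first.
  rewrite negb_forall => /existsP[s gt_s].
  have [pair|le_s] := hyperplane_pair_or_card_zeros (homg s) (nzg s).
    exists (f + s *: f'); split=> //; exists 1, s; rewrite scale1r; split=> //.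
    by rewrite xpair_eqE oner_eq0.
  by rewrite -hq le_s in gt_s.
move/forallP => le_g; exfalso.
(* Of the f + s f' only the singular ones, at most nine, can exceed q^4. *)
have le_gs s : (#|zeros (value (f + s *: f')) setT|
    <= q ^ 4 + root P s * (q ^ 3 - q ^ 2))%N.
  have [_|nroot] := boolP (root P s); first by rewrite mul1n.
  rewrite mul0n addn0 -hq; apply: card_zeros_nonsingular_form => // sing.
  by rewrite Psing in nroot.
have roots9 : (\sum_s root P s <= 9)%N.
  have -> : (\sum_s root P s = #|[pred s | root P s]|)%N.
    by rewrite -sum1_card [RHS]big_mkcond; apply: eq_bigr => s _; rewrite inE; case: root.
  rewrite cardE -ltnS; apply: leq_trans sP; apply: max_poly_roots => //.
    by apply/allP => s; rewrite mem_enum.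
  exact: enum_uniq.
have := sum_zeros_pencil (value f) (value f').
have -> : [set x | value f' x == 0] = zeros (value f') setT.
  by apply/setP => x; rewrite !inE.
have -> : [set x | (value f x == 0) && (value f' x == 0)] = common_zeros f f' by [].
have -> : (\sum_s #|[set x | (value f x + s * value f' x == 0)%R]|
    = \sum_s #|zeros (value (f + s *: f')) setT|)%N.
  apply: eq_bigr => s _; apply: eq_card => x.
  by rewrite !inE /value mevalD mevalZ.
have := leq_sum (index_enum F) (fun s (_ : true) => le_gs s).
rewrite big_split sum_nat_const -big_distrl /=.
have := card_points_le_zeros f f'.
have -> : #|common_zeros f f' :\ 0%R| = #|common_zeros f f'|.-1.
  rewrite [in RHS](cardsD1 0%R) inE.
  by rewrite !(quadratic0 (quadratic_value _)) ?eqxx.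
have : (0 < #|common_zeros f f'|)%N.
  apply/card_gt0P; exists 0; rewrite inE.
  by rewrite !(quadratic0 (quadratic_value _)) ?eqxx.
have q1 := card_field_gt1 F; rewrite card_mx mul1n.
rewrite hq in q1 le_f' *.
move=> N0 le_points le_S eS.
exact: (pencil_count_absurd roots9 le_f' hV q1 N0 le_points le_S eS).
Qed.
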